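(* Reciprocal forms correspond to reciprocal çarks: a çark $\mathcal{C}$ is reciprocal (that is, $\mathcal{C}$ and $(\mathcal{C}^{m})^{r}$ are isomorphic as çarks) if and only if the class of binary quadratic forms represented by $\mathcal{C}$ contains a reciprocal form.
   Context: Let $S(z)=-1/z$, $R(z)=(z-1)/z$. The bipartite Farey tree $\mathcal{F}$ has edges $\{W\}$, $\otimes$-vertices $\{W,WS\}$, $\bullet$-vertices $\{W,WR,WR^2\}$ ($W\in\mathrm{PSL}_2(\mathbf{Z})$); the edge $\{W\}$ joins $\{W,WS\}$ to $\{W,WR,WR^2\}$. $\mathrm{PSL}_2(\mathbf{Z})$ acts on it by left multiplication. $\mathcal{F}$ is realized in the upper half plane $\mathcal{H}$ as the orbit of the geodesic arc from $i$ (the vertex $\{I,S\}$) to $e^{i\pi/3}$ (the vertex $\{I,R,R^2\}$). A çark is $\langle M\rangle\backslash\mathcal{F}$ with $M\in \mathrm{PSL}_2(\mathbf{Z})$ hyperbolic, embedded in the annulus $\langle M\rangle\backslash\mathcal{H}$; its unique circuit, the image of the axis of $M$ in $\mathcal{F}$, is the spine, directed by the translation direction of $M$. The annulus is viewed, compatibly with orientation, as a round annulus in the plane with the spine running counterclockwise, so the inner boundary is to the left of the directed spine. All çarks here are considered with this convention, and isomorphisms of çarks preserve the ribbon structure and the direction of the spine (hence inner and outer boundary). At each $\bullet$-vertex of the spine an infinite Farey branch is attached, going to the inner or the outer boundary. A çark is thus determined by the cyclic word in the letters ''inner'', ''outer'' read along the counterclockwise spine. $\mathcal{C}^r$ is the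 mirror image of $\mathcal{C}$ about a line through the centre of the spine: the cyclic word is reversed and inner/outer are kept. $\mathcal{C}^m$ is the reflection of $\mathcal{C}$ with respect to the spine: inner and outer are swapped and the order is kept. In both cases the spine is again directed counterclockwise. $\mathcal{C}$ is reciprocal if $\mathcal{C}\cong(\mathcal{C}^m)^r$. Forms: $(A,B,C)$ denotes $Ax^2+Bxy+Cy^2$ with $A,B,C\in\mathbf{Z}$, and $\mathrm{PSL}_2(\mathbf{Z})$ acts by $(U\cdot f)(x,y)=f(U(x,y)^t)$; classes are orbits. For hyperbolic $M=\begin{pmatrix}p&q\\ r&s\end{pmatrix}$ put $f_M=\frac{\mathrm{sgn}(p+s)}{\gcd(q,s-p,r)}(r,s-p,-q)$, a primitive indefinite form; the çark $\langle M\rangle\backslash\mathcal{F}$ directed by $M$ represents the class $[f_M]$. A form $(A,B,C)$ is reciprocal if $C=-A$. *)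

(* Defs.v *)
From HB Require Import structures.
From mathcomp Require Import all_boot all_order all_algebra.
From mathcomp Require Import ring.
From mathcomp Require Import boolp.

Set Implicit Arguments.
Unset Strict Implicit.
Unset Printing Implicit Defensive.

Import Order.TTheory GRing.Theory Num.Theory.
Local Open Scope ring_scope.
Local Open Scope quotient_scope.

(** * The groups SL_2(Z) and PSL_2(Z) *)

Record SL2Z := MkSL2Z { slmx :> 'M[int]_2; slmxP : \det slmx == 1 }.

HB.instance Definition _ := [isSub for slmx].
HB.instance Definition _ := [Choice of SL2Z by <:].

Lemma det_sl (A : SL2Z) : \det (slmx A) = 1.
Proof. exact/eqP/slmxP. Qed.

Lemma sl_unit (A : SL2Z) : slmx A \in unitmx.
Proof. by rewrite unitmxE det_sl unitr1. Qed.

Fact sl_one_subproof : \det (1%:M : 'M[int]_2) == 1.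
Proof. by rewrite det1. Qed.
Definition sl_one := MkSL2Z sl_one_subproof.

Fact sl_mul_subproof (A B : SL2Z) : \det (slmx A *m slmx B) == 1.
Proof. by rewrite det_mulmx !det_sl mulr1. Qed.
Definition sl_mul (A B : SL2Z) := MkSL2Z (sl_mul_subproof A B).

Fact sl_inv_subproof (A : SL2Z) : \det (invmx (slmx A)) == 1.
Proof. by rewrite det_inv det_sl invr1. Qed.
Definition sl_inv (A : SL2Z) := MkSL2Z (sl_inv_subproof A).

Fact sl_mulA : associative sl_mul.
Proof. by move=> A B C; apply: val_inj; rewrite /= mulmxA. Qed.
Fact sl_mul1 : left_id sl_one sl_mul.
Proof. by move=> A; apply: val_inj; rewrite /= mul1mx. Qed.
Fact sl_mulr1 : right_id sl_one sl_mul.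
Proof. by move=> A; apply: val_inj; rewrite /= mulmx1. Qed.
Fact sl_mulV : left_inverse sl_one sl_inv sl_mul.
Proof. by move=> A; apply: val_inj; rewrite /= mulVmx ?sl_unit. Qed.
Fact sl_mulrV : right_inverse sl_one sl_inv sl_mul.
Proof. by move=> A; apply: val_inj; rewrite /= mulmxV ?sl_unit. Qed.

HB.instance Definition _ :=
  isGroup.Build SL2Z sl_mulA sl_mul1 sl_mulr1 sl_mulV sl_mulrV.

Definition sign_eq : rel SL2Z :=
  fun A B => (slmx A == slmx B) || (slmx A == - slmx B).

Lemma sign_eqP (A B : SL2Z) :
  reflect (slmx A = slmx B \/ slmx A = - slmx B) (sign_eq A B).
Proof. by apply: (iffP orP) => -[/eqP|/eqP]; [left|right|left|right]. Qed.

Fact sign_eq_refl : reflexive sign_eq.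
Proof. by move=> A; rewrite /sign_eq eqxx. Qed.
Fact sign_eq_sym : symmetric sign_eq.
Proof.
by move=> A B; rewrite /sign_eq [slmx B == slmx A]eq_sym
  [slmx B == _]eq_sym eqr_oppLR.
Qed.
Fact sign_eq_trans : transitive sign_eq.
Proof.
move=> B A C /sign_eqP AB /sign_eqP BC; apply/sign_eqP.
case: AB BC => -> [] ->; rewrite ?opprK; by [left|right].
Qed.

Canonical sign_equiv := EquivRel sign_eq sign_eq_refl sign_eq_sym sign_eq_trans.

Definition PSL2Z := {eq_quot sign_equiv}.
HB.instance Definition _ := Choice.on PSL2Z.
HB.instance Definition _ := EqQuotient.on PSL2Z.

Definition psl_one : PSL2Z := \pi_PSL2Z (1%g : SL2Z).
Definition psl_mul (U V : PSL2Z) : PSL2Z := \pi_PSL2Z (repr U * repr V)%g.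
Definition psl_inv (U : PSL2Z) : PSL2Z := \pi_PSL2Z ((repr U)^-1)%g.

Lemma repr_pi (A : SL2Z) :
  slmx (repr (\pi_PSL2Z A)) = slmx A \/ slmx (repr (\pi_PSL2Z A)) = - slmx A.
Proof.
have /eqmodP/sign_eqP // : repr (\pi_PSL2Z A) = A %[mod_eq sign_equiv].
by rewrite reprK.
Qed.

Lemma pi_mul (A B : SL2Z) :
  psl_mul (\pi_PSL2Z A) (\pi_PSL2Z B) = \pi_PSL2Z (A * B)%g.
Proof.
apply/eqmodP/sign_eqP => /=.
case: (repr_pi A) => ->; case: (repr_pi B) => ->;
  rewrite ?mulNmx ?mulmxN ?opprK; by [left|right].
Qed.

Lemma pi_inv (A : SL2Z) : psl_inv (\pi_PSL2Z A) = \pi_PSL2Z (A^-1)%g.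
Proof.
apply/eqmodP/sign_eqP => /=.
case: (repr_pi A) => ->; [by left|right].
by rewrite -[LHS]/((- slmx A)^-1) invrN.
Qed.

Fact psl_mulA : associative psl_mul.
Proof.
move=> U V W; rewrite -[U]reprK -[V]reprK -[W]reprK.
rewrite (pi_mul (repr V)) (pi_mul (repr U) (repr V)).
by rewrite (pi_mul (repr U)) (pi_mul (_ * _)%g) mulgA.
Qed.
Fact psl_mul1 : left_id psl_one psl_mul.
Proof. by move=> U; rewrite -[U]reprK pi_mul mul1g. Qed.
Fact psl_mulr1 : right_id psl_one psl_mul.
Proof. by move=> U; rewrite -[U]reprK pi_mul mulg1. Qed.
Fact psl_mulV : left_inverse psl_one psl_inv psl_mul.
Proof. by move=> U; rewrite -[U]reprK pi_inv pi_mul mulVg. Qed.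
Fact psl_mulrV : right_inverse psl_one psl_inv psl_mul.
Proof. by move=> U; rewrite -[U]reprK pi_inv pi_mul mulgV. Qed.

HB.instance Definition _ :=
  isGroup.Build PSL2Z psl_mulA psl_mul1 psl_mulr1 psl_mulV psl_mulrV.

(** A representative, defined up to sign, of an element of PSL_2(Z). *)
Definition psl_mx (U : PSL2Z) : 'M[int]_2 := slmx (repr U).

Definition mx2 (a b c d : int) : 'M[int]_2 :=
  \matrix_(i < 2, j < 2)
    if i == 0 then (if j == 0 then a else b) else (if j == 0 then c else d).

Lemma det_mx2 a b c d : \det (mx2 a b c d) = a * d - b * c.
Proof.
rewrite (expand_det_row _ ord0) !big_ord_recl big_ord0 /cofactor !det_mx11.
by rewrite !mxE /=; ring.
Qed.

Fact Smx_subproof : \det (mx2 0 (-1) 1 0) == 1.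
Proof. by rewrite det_mx2. Qed.
Fact Rmx_subproof : \det (mx2 1 (-1) 1 0) == 1.
Proof. by rewrite det_mx2. Qed.

Definition S_ : PSL2Z := \pi_PSL2Z (MkSL2Z Smx_subproof).
Definition R_ : PSL2Z := \pi_PSL2Z (MkSL2Z Rmx_subproof).

Lemma mulSS : (S_ * S_)%g = 1%g.
Proof.
rewrite [LHS]pi_mul; apply/eqmodP/sign_eqP; right; apply/matrixP => i j.
rewrite !mxE big_ord_recl big_ord1 !mxE.
by case: i j => [[|[|//]] ?] [[|[|//]] ?].
Qed.

Lemma mulRRR : (R_ * R_ * R_)%g = 1%g.
Proof.
rewrite [(R_ * R_)%g]pi_mul [LHS]pi_mul; apply/eqmodP/sign_eqP; right.
apply/matrixP => i j; do 3 rewrite ?mxE ?big_ord_recl ?big_ord0.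
by case: i j => [[|[|//]] ?] [[|[|//]] ?].
Qed.

Definition hyperbolic (M : PSL2Z) : Prop := 2 < `|\tr (psl_mx M)|.

(** * Bipartite ribbon graphs *)

(** A bipartite ribbon graph whose ⊗-vertices have degree 2 and whose
    •-vertices have degree 3 is given by its set of edges: the vertices are the
    orbits of [tw] (⊗-vertices) and of [ccw] (•-vertices), an edge joining the
    two orbits it lies in, and [ccw] is the counterclockwise successor around
    the •-vertex of an edge.  A cyclic order on two edges carries no
    information. *)
Record ribbon_graph := RibbonGraph {
  edge :> Type;
  tw : edge -> edge;
  ccw : edge -> edge;
  twK : forall e, tw (tw e) = e;
  ccwK : forall e, ccw (ccw (ccw e)) = e
}.

Variant direction := to_otimes | to_bullet.

Definition flip (d : direction) : direction :=
  if d is to_otimes then to_bullet else to_otimes.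

(** [spine d e] says that the directed spine runs along the edge [e], from its
    •-vertex to its ⊗-vertex when [d = to_otimes], the other way when
    [d = to_bullet]. *)
Record spined_graph := SpinedGraph {
  sgraph :> ribbon_graph;
  spine : direction -> edge sgraph -> Prop
}.

Definition cark_iso (C D : spined_graph) : Prop :=
  exists2 phi : C -> D, bijective phi &
    [/\ forall e, phi (tw e) = tw (phi e),
        forall e, phi (ccw e) = ccw (phi e)
      & forall d e, spine d e <-> spine d (phi e)].

(** ** Mirror images *)

Definition mirror_graph (G : ribbon_graph) : ribbon_graph :=
  @RibbonGraph (edge G) (@tw G) (fun e => ccw (ccw e)) (@twK G)
    (fun e => etrans (congr1 (fun x => ccw x) (ccwK (ccw (ccw e)))) (ccwK e)).

(** The reflection with respect to the spine reverses the orientation of the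
    annulus and fixes the spine, which therefore remains counterclockwise. *)
Definition mirror_m (C : spined_graph) : spined_graph :=
  @SpinedGraph (mirror_graph C) (fun d e => spine (s := C) d e).

(** The reflection about a line through the centre reverses the orientation of
    the annulus and carries the spine to a clockwise circuit, whose direction
    has to be flipped. *)
Definition mirror_r (C : spined_graph) : spined_graph :=
  @SpinedGraph (mirror_graph C) (fun d e => spine (s := C) (flip d) e).

(** Let [b] be a branch edge at a •-vertex of the spine.  If the spine enters
    this vertex along [ccw b] and leaves it along [ccw (ccw b)], it turns right,
    so [b] is on its left, the side of the inner boundary. *)
Definition inner (C : spined_graph) (b : C) : Prop :=
  spine to_bullet (ccw b) /\ spine to_otimes (ccw (ccw b)).

Definition outer (C : spined_graph) (b : C) : Prop :=
  spine to_bullet (ccw (ccw b)) /\ spine to_otimes (ccw b).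

(** The spine passes from the •-vertex of [b] to the •-vertex of [b'] through
    a single ⊗-vertex. *)
Definition next_vertex (C : spined_graph) (b b' : C) : Prop :=
  exists e : C, [/\ spine to_otimes e, spine to_bullet (tw e),
    e = ccw b \/ e = ccw (ccw b) & tw e = ccw b' \/ tw e = ccw (ccw b')].

Lemma inner_mirror_m (C : spined_graph) (b : C) :
  inner (C := mirror_m C) b <-> outer b.
Proof. by rewrite /inner /outer /= ccwK. Qed.

Lemma outer_mirror_m (C : spined_graph) (b : C) :
  outer (C := mirror_m C) b <-> inner b.
Proof. by rewrite /inner /outer /= ccwK. Qed.

Lemma next_vertex_mirror_m (C : spined_graph) (b b' : C) :
  next_vertex (C := mirror_m C) b b' <-> next_vertex b b'.
Proof.
by rewrite /next_vertex /= !ccwK; split=> -[e [? ? [?|?] [?|?]]];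
  exists e; split; auto.
Qed.

Lemma inner_mirror_r (C : spined_graph) (b : C) :
  inner (C := mirror_r C) b <-> inner b.
Proof. by rewrite /inner /= ccwK; split=> -[]. Qed.

Lemma outer_mirror_r (C : spined_graph) (b : C) :
  outer (C := mirror_r C) b <-> outer b.
Proof. by rewrite /outer /= ccwK; split=> -[]. Qed.

Lemma next_vertex_mirror_r (C : spined_graph) (b b' : C) :
  next_vertex (C := mirror_r C) b b' <-> next_vertex b' b.
Proof.
by rewrite /next_vertex /= !ccwK; split=> -[e [? ? [?|?] [?|?]]];
  exists (tw e); split; rewrite ?twK; auto.
Qed.

(** * The Farey tree *)

Fact farey_twK (W : PSL2Z) : (W * S_ * S_)%g = W.
Proof. by rewrite -mulgA mulSS mulg1. Qed.

Fact farey_ccwK (W : PSL2Z) : (W * R_^-1 * R_^-1 * R_^-1)%g = W.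
Proof.
by rewrite -[in LHS](mulg1 W) -mulRRR !mulgA !mulgK.
Qed.

(** Around e^(iπ/3) the edges I, R and R^2 lead to i, 1 + i and (1 + i)/2, so
    that their counterclockwise order is I, R^2, R. *)
Definition farey : ribbon_graph :=
  @RibbonGraph PSL2Z (fun W => W * S_)%g (fun W => W * R_^-1)%g
    farey_twK farey_ccwK.

(** The successive edges of a bi-infinite path without backtracking; the edges
    of even index are traversed from their •-vertex to their ⊗-vertex. *)
Definition biinfinite_path (G : ribbon_graph) (g : int -> G) : Prop :=
  forall k : int,
    g (2 * k + 1) = tw (g (2 * k)) /\
    (g (2 * k + 2) = ccw (g (2 * k + 1)) \/
     g (2 * k + 2) = ccw (ccw (g (2 * k + 1)))).

(** The axis of [M], parametrized in the translation direction of [M]. *)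
Definition is_axis (M : PSL2Z) (g : int -> farey) : Prop :=
  biinfinite_path g /\
  exists2 n : int, 0 < n & forall k, (M * g k)%g = g (k + n).

Definition axis (M : PSL2Z) (d : direction) (W : farey) : Prop :=
  exists2 g : int -> farey, is_axis M g &
    exists k : int, W = g (if d is to_otimes then 2 * k else 2 * k + 1).

(** * Çarks *)

Definition powz (M : PSL2Z) (k : int) : PSL2Z :=
  match k with Posz n => (M ^+ n)%g | Negz n => (M ^- n.+1)%g end.

Definition cark_eq (M : PSL2Z) : rel PSL2Z :=
  fun W W' => `[< exists k : int, W' = (powz M k * W)%g >].

Lemma cark_eqE M W W' :
  cark_eq M W W' <-> exists a b : nat, (M ^+ a * W)%g = (M ^+ b * W')%g.
Proof.
split=> [/asboolP[[n|n] ->]|[a [b ab]]].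
- by exists n, 0%N; rewrite mul1g.
- by exists 0%N, n.+1; rewrite mulgA mulgV !mul1g.
apply/asboolP; case: (leqP b a) => [ba|/ltnW ba].
  exists (a - b)%N; apply: (mulgI (M ^+ b)%g).
  by rewrite -ab mulgA -expgnDr subnKC.
have E : W = (M ^+ (b - a) * W')%g.
  by apply: (mulgI (M ^+ a)%g); rewrite ab mulgA -expgnDr subnKC.
case: (b - a)%N E => [|n] E; first by exists 0; rewrite E !mul1g.
by exists (Negz n); rewrite E mulgA mulVg mul1g.
Qed.

Fact cark_eq_refl M : reflexive (cark_eq M).
Proof. by move=> W; apply/cark_eqE; exists 0%N, 0%N. Qed.
Fact cark_eq_sym M : symmetric (cark_eq M).
Proof.
by move=> W W'; apply/idP/idP => /cark_eqE[a [b E]]; apply/cark_eqE;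
  exists b, a.
Qed.
Fact cark_eq_trans M : transitive (cark_eq M).
Proof.
move=> V W U /cark_eqE[a [b ab]] /cark_eqE[c [d cd]]; apply/cark_eqE.
exists (c + a)%N, (b + d)%N.
by rewrite !expgnDr -!mulgA ab -cd !mulgA -!expgnDr addnC.
Qed.

Canonical cark_equiv M :=
  EquivRel (cark_eq M) (@cark_eq_refl M) (@cark_eq_sym M) (@cark_eq_trans M).

(** The coset space ⟨M⟩\PSL_2(Z). *)
Definition cark_edge (M : PSL2Z) := {eq_quot cark_equiv M}.
HB.instance Definition _ M := Choice.on (cark_edge M).
HB.instance Definition _ M := EqQuotient.on (cark_edge M).

Definition cark_rmul (M V : PSL2Z) (e : cark_edge M) : cark_edge M :=
  \pi_(cark_edge M) (repr e * V)%g.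

Lemma cark_rmulE M V W :
  cark_rmul V (\pi_(cark_edge M) W) = \pi_(cark_edge M) (W * V)%g.
Proof.
apply/eqmodP/cark_eqE.
have /eqmodP/cark_eqE[a [b E]] :
    repr (\pi_(cark_edge M) W) = W %[mod_eq cark_equiv M] by rewrite reprK.
by exists a, b; rewrite !mulgA E.
Qed.

Fact cark_twK M (e : cark_edge M) : cark_rmul S_ (cark_rmul S_ e) = e.
Proof. by rewrite -[e]reprK (cark_rmulE M S_ (repr e)) cark_rmulE farey_twK. Qed.

Fact cark_ccwK M (e : cark_edge M) :
  cark_rmul R_^-1%g (cark_rmul R_^-1%g (cark_rmul R_^-1%g e)) = e.
Proof.
rewrite -[e]reprK (cark_rmulE M R_^-1%g (repr e)).
by rewrite (cark_rmulE M R_^-1%g (_ * _)%g) cark_rmulE farey_ccwK.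
Qed.

(** The quotient of the Farey tree by ⟨M⟩, directed by [M]. *)
Definition cark (M : PSL2Z) : spined_graph :=
  @SpinedGraph
    (@RibbonGraph (cark_edge M) (cark_rmul S_) (cark_rmul R_^-1%g)
       (@cark_twK M) (@cark_ccwK M))
    (fun d e => exists2 W, axis M d W & e = \pi_(cark_edge M) W).

Definition reciprocal_cark (C : spined_graph) : Prop :=
  cark_iso C (mirror_r (mirror_m C)).

(** * Binary quadratic forms *)

Record bqf := Bqf { qa : int; qb : int; qc : int }.

Definition bqf_eval (f : bqf) (x y : int) : int :=
  qa f * x ^+ 2 + qb f * x * y + qc f * y ^+ 2.

Definition bqf_act_mx (U : 'M[int]_2) (f : bqf) : bqf :=
  let: a := U 0 0 in let: b := U 0 1 in let: c := U 1 0 in let: d := U 1 1 in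
  Bqf (qa f * a ^+ 2 + qb f * a * c + qc f * c ^+ 2)
      (2 * qa f * a * b + qb f * (a * d + b * c) + 2 * qc f * c * d)
      (qa f * b ^+ 2 + qb f * b * d + qc f * d ^+ 2).

Lemma bqf_act_mxE U f x y :
  bqf_eval (bqf_act_mx U f) x y =
  bqf_eval f (U 0 0 * x + U 0 1 * y) (U 1 0 * x + U 1 1 * y).
Proof. by rewrite /bqf_eval /=; ring. Qed.

Lemma bqf_act_mxN U f : bqf_act_mx (- U) f = bqf_act_mx U f.
Proof. by rewrite /bqf_act_mx !mxE; congr Bqf; ring. Qed.

Definition bqf_act (U : PSL2Z) (f : bqf) : bqf := bqf_act_mx (psl_mx U) f.

Definition bqf_class (f g : bqf) : Prop := exists U : PSL2Z, g = bqf_act U f.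

Definition bqf_mx (M : 'M[int]_2) : bqf :=
  let: p := M 0 0 in let: q := M 0 1 in let: r := M 1 0 in let: s := M 1 1 in
  let: g := gcdz (gcdz q (s - p)) r in
  let: e := sgz (p + s) in
  Bqf (e * (r %/ g)%Z) (e * ((s - p) %/ g)%Z) (e * ((- q) %/ g)%Z).

Lemma bqf_mxN (M : 'M[int]_2) : bqf_mx (- M) = bqf_mx M.
Proof.
rewrite /bqf_mx !mxE -opprD sgzN.
have -> : - M 1 1 - - M 0 0 = - (M 1 1 - M 0 0) by rewrite opprB opprK addrC.
rewrite !gcdzN gcdNz; move: (M 0 1) (M 1 1 - M 0 0) (M 1 0) => q t r.
have gx := dvdz_gcdl (gcdz q t) r; have gr := dvdz_gcdr (gcdz q t) r.
have gq := dvdz_trans gx (dvdz_gcdl q t).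
have gt := dvdz_trans gx (dvdz_gcdr q t).
set g := gcdz _ r in gr gq gt *.
have divN x : (g %| x)%Z -> ((- x) %/ g)%Z = - (x %/ g)%Z.
  by move=> gx'; rewrite -mulN1r -mulz_divA // mulN1r.
by rewrite opprK !divN // !mulrNN mulNr mulrN.
Qed.

(** The form [f_M], representative of the class represented by [cark M]. *)
Definition bqf_of (M : PSL2Z) : bqf := bqf_mx (psl_mx M).

Definition reciprocal_bqf (f : bqf) : Prop := qc f = - qa f.

(* Main.v *)
From HB Require Import structures.
From mathcomp Require Import all_boot all_order all_algebra.
From mathcomp Require Import zify ring boolp.
Require Import Defs.

Set Implicit Arguments.
Unset Strict Implicit.
Unset Printing Implicit Defensive.

Import Order.TTheory GRing.Theory Num.Theory.
Local Open Scope ring_scope.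
Local Open Scope quotient_scope.

(** Both conditions say that M is conjugate to its inverse.  A çark isomorphism
    commutes with right multiplication by S and R, hence is left multiplication
    by some V normalizing ⟨M⟩; since it reverses the spine, V M V^-1 = M^-1.
    This rests on two facts about the Farey tree: a hyperbolic element has an
    axis, being conjugate to a product of syllables S R and S R^-1, and an edge
    is never traversed by axes of M in both directions, since up to sign such
    products have entries of signs (+, -; -, +) while conjugation by S makes
    the signs (+, +; +, +).
    On the side of forms, V M V^-1 = M^-1 forces tr V = 0, so that
    V = U S U^-1 for some U, and the same equation says exactly that the outer
    coefficients of U . f_M are opposite. *)

(** * Matrix representatives in PSL_2(Z) *)

Lemma mx2_eta (A : 'M[int]_2) : A = mx2 (A 0 0) (A 0 1) (A 1 0) (A 1 1).
Proof.
by apply/matrixP => -[[|[|//]] i] [[|[|//]] j]; rewrite !mxE /=; congr (A _ _);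
  apply: val_inj.
Qed.

Lemma mulmx2 a b c d a' b' c' d' :
  mx2 a b c d *m mx2 a' b' c' d' =
  mx2 (a * a' + b * c') (a * b' + b * d') (c * a' + d * c') (c * b' + d * d').
Proof.
by apply/matrixP => -[[|[|//]] i] [[|[|//]] j];
  rewrite !mxE !big_ord_recl big_ord0 !mxE /= addr0.
Qed.

Lemma oppmx2 a b c d : - mx2 a b c d = mx2 (- a) (- b) (- c) (- d).
Proof. by apply/matrixP => -[[|[|//]] i] [[|[|//]] j]; rewrite !mxE. Qed.

Lemma mx2_inj a b c d a' b' c' d' : mx2 a b c d = mx2 a' b' c' d' ->
  [/\ a = a', b = b', c = c' & d = d'].
Proof.
move=> /matrixP E.
by move: (E 0 0) (E 0 1) (E 1 0) (E 1 1); rewrite !mxE.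
Qed.

(** [U] is represented by the matrix with rows [(a, b)] and [(c, d)]. *)
Definition entries (U : PSL2Z) (a b c d : int) : Prop :=
  psl_mx U = mx2 a b c d \/ psl_mx U = - mx2 a b c d.

Lemma entries_psl_mx U :
  entries U (psl_mx U 0 0) (psl_mx U 0 1) (psl_mx U 1 0) (psl_mx U 1 1).
Proof. by left; exact: mx2_eta. Qed.

Lemma entries_det U a b c d : entries U a b c d -> a * d - b * c = 1.
Proof.
have := det_sl (repr U); rewrite -/(psl_mx U) => dU EU.
by case: EU dU => ->; rewrite ?oppmx2 det_mx2 ?mulrNN.
Qed.

Lemma entries_pi (A : SL2Z) a b c d :
  slmx A = mx2 a b c d -> entries (\pi_PSL2Z A) a b c d.
Proof. by rewrite /entries /psl_mx => E; case: (repr_pi A); rewrite E; [left|right]. Qed.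

Lemma entries_ex a b c d : a * d - b * c = 1 -> exists U, entries U a b c d.
Proof.
move=> D; have E : \det (mx2 a b c d) == 1 by rewrite det_mx2 D.
by exists (\pi_PSL2Z (MkSL2Z E)); apply: entries_pi.
Qed.

Lemma entries_inj U V a b c d :
  entries U a b c d -> entries V a b c d -> U = V.
Proof.
move=> EU EV; rewrite -[U]reprK -[V]reprK; apply/eqmodP/sign_eqP.
rewrite -/(psl_mx U) -/(psl_mx V).
by case: EU => ->; case: EV => ->; rewrite ?opprK; by [left|right].
Qed.

Lemma entriesN U a b c d :
  entries U a b c d -> entries U (- a) (- b) (- c) (- d).
Proof. by case=> E; [right|left]; rewrite E ?oppmx2 ?opprK. Qed.

Lemma entries_uniq U a b c d a' b' c' d' :
  entries U a b c d -> entries U a' b' c' d' ->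
  [/\ a = a', b = b', c = c' & d = d'] \/
  [/\ a = - a', b = - b', c = - c' & d = - d'].
Proof.
rewrite {2}/entries; case=> -> [] E; [left|right|right|left].
- exact: mx2_inj.
- by apply: mx2_inj; rewrite -oppmx2.
- by apply: mx2_inj; rewrite -oppmx2 -E opprK.
- by apply: mx2_inj; apply: oppr_inj.
Qed.

Lemma entriesM U V a b c d a' b' c' d' :
  entries U a b c d -> entries V a' b' c' d' ->
  entries (U * V)%g
    (a * a' + b * c') (a * b' + b * d') (c * a' + d * c') (c * b' + d * d').
Proof.
rewrite /entries -mulmx2 => EU EV; rewrite /psl_mx.
case: (repr_pi (repr U * repr V)%g) => -> /=;
  rewrite -/(psl_mx U) -/(psl_mx V); case: EU => ->; case: EV => ->;
  rewrite ?mulmxN ?mulNmx ?opprK; by [left|right].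
Qed.

Lemma entries1 : entries 1%g 1 0 0 1.
Proof.
apply: entries_pi; rewrite /= (mx2_eta 1%:M).
by rewrite !mxE.
Qed.

Lemma entriesV U a b c d :
  entries U a b c d -> entries U^-1%g d (- b) (- c) a.
Proof.
move=> EU; have D := entries_det EU.
have [V EV] : exists V, entries V d (- b) (- c) a.
  by apply: entries_ex; rewrite -D; ring.
suff -> : U^-1%g = V by [].
apply: (mulgI U); rewrite mulgV; apply: (entries_inj entries1).
have := entriesM EU EV.
have -> : a * d + b * - c = 1 by rewrite -D; ring.
have -> : a * - b + b * a = 0 by ring.
have -> : c * d + d * - c = 0 by ring.
by have -> : c * - b + d * a = 1 by rewrite -D; ring.
Qed.

Lemma entriesS : entries S_ 0 (-1) 1 0.
Proof. exact: entries_pi. Qed.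

Lemma entriesR : entries R_ 1 (-1) 1 0.
Proof. exact: entries_pi. Qed.

Lemma hyperbolicE U a b c d :
  entries U a b c d -> hyperbolic U <-> 2 < `|a + d|.
Proof.
have trE x y z t : \tr (mx2 x y z t) = x + t.
  by rewrite /mxtrace !big_ord_recl big_ord0 !mxE /= addr0.
by rewrite /hyperbolic => -[] ->; rewrite ?oppmx2 trE -?opprD ?normrN.
Qed.

(** The Euclidean algorithm on the bottom row shows that [S_] and [R_] generate the group; the
    relations S^2 = R^3 = 1 make it possible to undo each multiplication. *)
Lemma psl_ind (P : PSL2Z -> Prop) :
  P 1%g -> (forall W, P W -> P (W * S_)%g) ->
  (forall W, P W -> P (W * R_^-1)%g) -> forall W, P W.
Proof.
move=> P1 PS PR.
have PSV W : P (W * S_)%g -> P W by move/PS; rewrite -mulgA mulSS mulg1.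
have PRV W : P (W * R_^-1)%g -> P W.
  by move=> /PR/PR; rewrite -[(_ * _ * _ * _)%g]/(ccw (ccw (ccw (W : farey)))) ccwK.
(* These are the inverse translations z + 1 and z - 1; on the right they add or subtract the first
   column to or from the second. *)
have T1 : entries (R_ * S_)%g 1 1 0 1.
  by have := entriesN (entriesM entriesR entriesS).
have T2 : entries (S_ * R_^-1)%g 1 (-1) 0 1.
  by have := entriesM entriesS (entriesV entriesR).
have PT W : P (W * (R_ * S_))%g -> P W.
  by rewrite mulgA => /PSV/PR; rewrite mulgK.
have PT' W : P (W * (S_ * R_^-1))%g -> P W.
  by rewrite mulgA => /PRV/PSV.
have PTn (n : nat) W a b c d : entries W a b c d ->
    (forall V, entries V a (b + a * n%:Z) c (d + c * n%:Z) -> P V) -> P W.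
  elim: n b d W => [|n IH] b d W EW H; first by apply: H; rewrite !mulr0 !addr0.
  have := entriesM EW T1; rewrite !(mulr1, mulr0, addr0) => EW1.
  apply: PT; apply: IH EW1 _.
  by move=> V EV; apply: H; move: EV; congr entries; rewrite intS; ring.
have PTn' (n : nat) W a b c d : entries W a b c d ->
    (forall V, entries V a (b - a * n%:Z) c (d - c * n%:Z) -> P V) -> P W.
  elim: n b d W => [|n IH] b d W EW H; first by apply: H; rewrite !mulr0 !subr0.
  have := entriesM EW T2; rewrite !(mulr1, mulr0, addr0) => EW1.
  apply: PT'; apply: IH EW1 _.
  by move=> V EV; apply: H; move: EV; congr entries; rewrite intS; ring.
have PTz (n : int) W a b c d : entries W a b c d ->
    (forall V, entries V a (b + a * n) c (d + c * n) -> P V) -> P W.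
  case: (intP n) => [|m|m] EW H.
  - by apply: H; rewrite !mulr0 !addr0.
  - exact: (PTn m.+1) EW H.
  - by apply: (PTn' m.+1) EW _ => V EV; apply: H; rewrite !mulrN.
move=> W; have [m] := ubnP `|(psl_mx W 1 0)%R|%N.
have := entries_psl_mx W.
move: (psl_mx W 0 0) (psl_mx W 0 1) (psl_mx W 1 0) (psl_mx W 1 1).
elim: m W => // m IH W a b c d EW lt_m.
have [c0|c0] := eqVneq c 0.
  move: EW; rewrite c0 => EW; have := entries_det EW; rewrite mulr0 subr0 => D.
  (* Here a = d is 1 or -1, so this shift turns b into b - a(ba) = 0 and leaves the identity up to
     sign. *)
  apply: (PTz (- (b * a)) _ _ _ _ _ EW) => V EV.
  suff -> : V = 1%g by [].
  have a1 : `|a|%N = 1%N.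
    by apply/eqP; have/eqP := congr1 absz D; rewrite abszM muln_eq1 => /andP[].
  have [ad b0] : d = a /\ b + a * - (b * a) = 0.
    by move: D a1 => /[swap] ?; have [->|->] : a = 1 \/ a = -1 by [lia|]; lia.
  move: EV; rewrite b0 mul0r addr0 ad => EV.
  have [a1'|a1'] : a = 1 \/ a = -1 by lia.
    by apply: entries_inj entries1; rewrite a1' in EV.
  by apply: entries_inj entries1; move/entriesN: EV; rewrite a1' opprK oppr0.
(* The shift replaces d by d mod c, which [S_] then brings to the lower left corner, where it is
   smaller than |c|. *)
apply: (PTz (- (d %/ c)%Z) _ _ _ _ _ EW) => V EV.
apply: PSV; apply: (IH _ _ _ _ _ (entriesM EV entriesS)).
have := modz_ge0 d c0; have := ltz_mod d c0; have := divz_eq d c.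
rewrite mulr0 add0r mulr1 mulrN mulrC.
move: (_ %/ _)%Z (d %% c)%Z lt_m; clear; nia.
Qed.

(** * Words in S R and S R^-1 *)

Lemma invS : (S_^-1)%g = S_.
Proof. by apply: (mulgI S_); rewrite mulgV mulSS. Qed.

Lemma mulRVRV : (R_^-1 * R_^-1)%g = R_.
Proof. by rewrite -[LHS]mul1g -mulRRR !mulgA !mulgK. Qed.

Lemma mulRR : (R_ * R_)%g = R_^-1%g.
Proof. by apply: (mulIg R_); rewrite mulRRR mulVg. Qed.

Lemma entries_conj V N a b c d : entries V a b c d -> forall p q r s,
  entries N p q r s -> exists p' q' r' s',
  entries (V * N * V^-1)%g p' q' r' s' /\ p' + s' = p + s.
Proof.
move=> EV p q r s EN; have D := entries_det EV.
do 4 eexists; split; first exact: entriesM (entriesM EV EN) (entriesV EV).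
by rewrite -[RHS]mulr1 -D; ring.
Qed.

Lemma hyperbolicJ V N : hyperbolic (V * N * V^-1)%g <-> hyperbolic N.
Proof.
have [p [q [r [s [EJ E]]]]] :=
  entries_conj (entries_psl_mx V) (entries_psl_mx N).
by rewrite (hyperbolicE EJ) (hyperbolicE (entries_psl_mx N)) E.
Qed.

Definition letter (b : bool) : PSL2Z := if b then R_ else R_^-1%g.

(** A step of a path: cross the ⊗-vertex, then turn at the next •-vertex. As R = R^-2, [true] is two
    [ccw] moves and [false] is one. *)
Definition syl (b : bool) : PSL2Z := (S_ * letter b)%g.

Definition word (w : seq bool) : PSL2Z := foldr (fun b W => syl b * W)%g 1%g w.

Lemma word_cat v w : word (v ++ w) = (word v * word w)%g.
Proof. by elim: v => [|b v IH] /=; rewrite ?mul1g // IH mulgA. Qed.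

Lemma word_rcons w b : word (rcons w b) = (word w * syl b)%g.
Proof. by rewrite -cats1 word_cat /= mulg1. Qed.

Lemma letter_mul b b' :
  (letter b * letter b')%g = if b == b' then letter (~~ b) else 1%g.
Proof. by case: b b' => -[] /=; rewrite ?mulRR ?mulRVRV ?mulgV ?mulVg. Qed.

(** Up to sign the syllables are (1, 0; -1, 1) and (1, -1; 0, 1), so the sign pattern (+, -; -, +)
    persists. Each new syllable adds one column to the other in absolute value; columns being
    nonzero, the sum of absolute values grows and bounds the length. *)
Lemma word_entries w :
  exists p q r s : nat, entries (word w) p%:Z (- q%:Z) (- r%:Z) s%:Z /\
    (p + q + r + s >= size w + 2)%N.
Proof.
elim/last_ind: w => [|w b [p [q [r [s [E L]]]]]].
  by exists 1%N, 0%N, 0%N, 1%N; split; first exact: entries1.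
have D := entries_det E; rewrite word_rcons size_rcons.
have qs : (0 < q + s)%N.
  rewrite lt0n addn_eq0; apply/negP => /andP[/eqP q0 /eqP s0].
  by move: D; rewrite q0 s0; lia.
have pr : (0 < p + r)%N.
  rewrite lt0n addn_eq0; apply/negP => /andP[/eqP q0 /eqP s0].
  by move: D; rewrite q0 s0; lia.
case: b.
  exists (p + q)%N, q, (r + s)%N, s; split; last by move: qs pr L; clear; lia.
  have := entriesN (entriesM E (entriesM entriesS entriesR)).
  by congr entries; rewrite ?PoszD; ring.
exists p, (p + q)%N, r, (r + s)%N; split; last by move: qs pr L; clear; lia.
have := entriesM E (entriesM entriesS (entriesV entriesR)).
by congr entries; rewrite ?PoszD; ring.
Qed.

Lemma word_eq1 w : word w = 1%g -> w = [::].
Proof.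
have [p [q [r [s [E L]]]]] := word_entries w => w1.
apply: size0nil; move: E; rewrite w1 => E.
by case: (entries_uniq E entries1) => -[]; move: L; clear; lia.
Qed.

(** Conjugation by [S_] makes all four signs equal, so equality with a matrix of pattern (+, -; -,
    +) forces zero entries: either the diagonal vanishes, against determinant 1, or the matrix is
    the identity up to sign. *)
Lemma word_conjS v w : (S_ * word v * S_)%g = word w -> w = [::].
Proof.
have [p [q [r [s [E L]]]]] := word_entries v.
have [p' [q' [r' [s' [E' L']]]]] := word_entries w => vw.
apply: size0nil; have := entriesM (entriesM entriesS E) entriesS.
rewrite vw => E''; have := entries_det E'; case: (entries_uniq E' E'') => -[].
  move=> ? ? ? ? D; move: D; have [-> ->] : p' = 0%N /\ s' = 0%N by lia.
  by rewrite mul0r; lia.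
move=> ? ? ? ?; have [-> ->] : q' = 0%N /\ r' = 0%N by lia.
move=> D; have /eqP : (p' * s' = 1)%N by lia.
rewrite muln_eq1; lia.
Qed.

(** * Axes in the Farey tree *)

Definition oletter (x : option bool) : PSL2Z := oapp letter 1%g x.
Definition tailS (y : bool) : PSL2Z := if y then S_ else 1%g.

(** This is the existence half of the normal form in the free product of Z/2 and Z/3: a generator
    appended on the right either extends the word or merges with its last letter. *)
Lemma psl_normal_form U :
  exists x w y, U = (oletter x * word w * tailS y)%g.
Proof.
elim/psl_ind: U => [|U [x [w [y ->]]]|U [x [w [y ->]]]].
- by exists None, [::], false; rewrite !mulg1.
- exists x, w, (~~ y); rewrite -mulgA.
  by case: y; rewrite /= ?mulSS ?mul1g.
case: y => /=.
  by exists x, (rcons w false), false; rewrite word_rcons /= /syl !mulgA mulg1.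
rewrite mulg1; case/lastP: w => [|w b].
  rewrite mulg1; case: x => [b|] /=; last first.
    by exists (Some false), [::], false; rewrite mul1g !mulg1.
  have /= -> := letter_mul b false; case: b => /=.
    by exists None, [::], false; rewrite !mulg1.
  by exists (Some true), [::], false; rewrite !mulg1.
rewrite word_rcons /syl -!mulgA; have /= -> := letter_mul b false.
case: b => /=; first by exists x, w, true; rewrite mulg1 mulgA.
exists x, (rcons w true), false.
by rewrite word_rcons /syl /= !mulgA mulg1.
Qed.

(** Cyclic reduction: conjugation carries the outer factor of the normal form to the other end,
    where it completes a syllable, merges or cancels. The degenerate ends 1, [S_] and a single
    letter have trace at most 2 in absolute value. *)
Lemma hyperbolic_conj_word U : hyperbolic U ->
  exists V w, w <> [::] /\ U = (V * word w * V^-1)%g.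
Proof.
have conj_trans V N : (hyperbolic (V * N * V^-1)%g ->
    exists V' w, w <> [::] /\ (V * N * V^-1)%g = (V' * word w * V'^-1)%g) ->
  hyperbolic N -> exists V' w, w <> [::] /\ N = (V' * word w * V'^-1)%g.
  move=> H /(hyperbolicJ V)/H[V' [w [w0 E]]].
  exists (V^-1 * V')%g, w; split=> //.
  apply: (mulgI V); apply: (mulIg V^-1%g); rewrite E invgM invgK.
  by rewrite !mulgA mulgV mul1g mulgK.
have [x [w [y ->]]] := psl_normal_form U.
have [m] := ubnP (size w); elim: m => // m IH in x w y *; rewrite ltnS => lt_m.
have triv v : v <> [::] -> exists V' w, w <> [::] /\
    word v = (V' * word w * V'^-1)%g.
  by move=> v0; exists 1%g, v; rewrite mul1g invg1 mulg1.
have rcons0 (v : seq bool) b : rcons v b <> [::] by case: v.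
case: y x => -[c|] /=; rewrite ?mul1g ?mulg1.
- apply: (conj_trans (letter c)^-1%g); rewrite invgK !mulgA mulVg mul1g -mulgA.
  by move=> _; rewrite -[(S_ * _)%g]/(syl c) -word_rcons; apply: triv.
- case: w lt_m => [_|b w lt_m] /=.
    by rewrite mul1g (hyperbolicE entriesS).
  apply: (conj_trans S_); rewrite invS /syl !mulgA mulSS mul1g.
  rewrite -(mulgA _ S_) mulSS mulg1.
  by have := IH (Some b) w false lt_m; rewrite /= mulg1.
- case/lastP: w lt_m => [|w b]; rewrite ?size_rcons => lt_m.
    rewrite mulg1; case: c => /=; first by rewrite (hyperbolicE entriesR).
    by rewrite (hyperbolicE (entriesV entriesR)).
  apply: (conj_trans (letter c)^-1%g); rewrite invgK !mulgA mulVg mul1g.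
  rewrite word_rcons /syl -!mulgA letter_mul.
  (* Equal letters combine into the opposite letter and leave a word; opposite letters cancel and
     leave a shorter word followed by [S_]. *)
  case: eqP => _.
    by move=> _; rewrite -[(S_ * _)%g]/(syl _) -word_rcons; apply: triv.
  by rewrite mulg1; have := IH None w true lt_m; rewrite /= mul1g.
case: w lt_m => [_|b w lt_m _]; last exact: triv.
by rewrite (hyperbolicE entries1).
Qed.

Lemma is_axisJ V M g :
  is_axis M g -> is_axis (V * M * V^-1)%g (fun k => V * g k)%g.
Proof.
move=> [pg [n n0 gn]]; split.
  move=> k; have [-> gS] := pg k; split; first by rewrite /= mulgA.
  by case: gS => -> /=; [left|right]; rewrite !mulgA.
by exists n => // k; rewrite -gn !mulgA mulgVK.
Qed.

Lemma is_axisX M g (n : nat) : is_axis M g -> is_axis (M ^+ n.+1)%g g.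
Proof.
move=> [pg [m m0 gm]]; split=> //; exists (m * n.+1%:Z); first by lia.
elim: n => [|n IH] k; first by rewrite mulr1 gm.
by rewrite expgS -mulgA IH gm; congr g; lia.
Qed.

(** The substitution 1 - k reverses the path and exchanges even and odd indices, as required when
    each edge is traversed the other way. The translate by [V] turns M^-1 into M, so the shift stays
    positive. *)
Lemma is_axis_rev V M g : (M * V = V * M^-1)%g ->
  is_axis M g -> is_axis M (fun k => V * g (1 - k))%g.
Proof.
move=> MV [pg [n n0 gn]]; split.
  move=> k; have [E gS] := pg (- k); split.
    have -> : 1 - (2 * k + 1) = 2 * - k by lia.
    have -> : 1 - 2 * k = 2 * - k + 1 by lia.
    by rewrite E /= !mulgA farey_twK.
  have [_ {}gS] := pg (- k - 1).
  have -> : 1 - (2 * k + 2) = 2 * (- k - 1) + 1 by lia.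
  have -> : 1 - (2 * k + 1) = 2 * (- k - 1) + 2 by lia.
  by case: gS => -> /=; [right|left]; rewrite !mulgA farey_ccwK.
exists n => // k; rewrite mulgA MV -mulgA; congr (_ * _)%g.
apply: (mulgI M); rewrite mulgA mulgV mul1g gn; congr g; lia.
Qed.

Lemma path_syl g k : biinfinite_path g ->
  exists b, g (2 * k + 2) = (g (2 * k)%R * syl b)%g :> farey.
Proof.
move=> pg; have [E [] ->] := pg k; rewrite E /=.
  by exists false; rewrite -mulgA.
by exists true; rewrite -2!mulgA mulRVRV.
Qed.

Lemma path_word (g : int -> farey) k (n : nat) : biinfinite_path g ->
  exists2 w, size w = n & g (2 * (k + n%:Z)) = (g (2 * k)%R * word w)%g.
Proof.
move=> pg; elim: n => [|n [w sw E]].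
  by exists [::]; rewrite ?addr0 //= mulg1.
have [b Eb] := path_syl (k + n%:Z) pg.
exists (rcons w b); first by rewrite size_rcons sw.
by rewrite word_rcons mulgA -E -Eb; congr g; lia.
Qed.

(** Squaring makes the shift 2n even, so that g(2k) is carried to an edge of even index, exactly n
    syllables further on. *)
Lemma axis_word M g k : is_axis M g ->
  exists2 w, w <> [::] & (M ^+ 2 * g (2 * k)%R = g (2 * k)%R * word w)%g.
Proof.
case=> pg [n n0 gn]; have [w sw E] := path_word k `|n|%N pg.
exists w; first by case: w sw {E} => //=; lia.
by rewrite -E expgS expg1 -mulgA !gn; congr g; lia.
Qed.

(** Otherwise a positive power of [M] is trivial; it still translates [g], which makes a nonempty
    word equal to 1. *)
Lemma axis_expg_inj M g (a b : nat) : is_axis M g ->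
  (M ^+ a = M ^+ b)%g -> a = b.
Proof.
move=> Mg.
wlog le_ab : a b / (a <= b)%N.
  move=> H E; case/orP: (leq_total a b) => le; first exact: H.
  by symmetry; apply: H.
move=> E; apply/eqP; rewrite eqn_leq le_ab leqNgt; apply/negP => lt_ab.
have E1 : (M ^+ (b - a) = 1)%g.
  by apply: (mulgI (M ^+ a)%g); rewrite -expgnDr subnKC // mulg1.
have [n En] : exists n, (b - a = n.+1)%N by exists (b - a).-1; lia.
have [w w0] := axis_word 0 (is_axisX n Mg).
rewrite -En E1 expg1n mul1g -{1}[g _]mulg1 => /mulgI/esym/word_eq1.
by [].
Qed.

Lemma axis_disjoint M W :
  axis M to_otimes W -> axis M to_bullet W -> False.
Proof.
move=> [g Mg [k ->]] [h Mh [l E]].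
have [w w0 Ew] := axis_word k Mg; have [v v0 Ev] := axis_word l Mh.
have [pg _] := Mh; have [Eh _] := pg l.
(* Read at the common edge, M^2 is spelled by [w] along [g] and by [v] along [h]; the base edges
   differ by [S_], so [S_] conjugates one word to the other. *)
apply: w0; apply: (@word_conjS v).
apply: (mulgI (g (2 * k)%R)); rewrite -Ew E Eh /=.
by rewrite !mulgA farey_twK Ev.
Qed.

(** The product of the first [k] letters' syllables of the periodic sequence [w w w ...]; for
    nonempty [w] the default [false] is never read. *)
Fixpoint ray (w : seq bool) (k : nat) : PSL2Z :=
  if k is j.+1 then (ray w j * syl (nth false w (j %% size w)))%g else 1%g.

Lemma ray_take w k : (k <= size w)%N -> ray w k = word (take k w).
Proof.
elim: k => [|k IH] lt_k /=; first by rewrite take0.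
by rewrite IH 1?ltnW // modn_small // (take_nth false) // word_rcons.
Qed.

(** Periodicity of the spelling becomes left translation by [word w], which is what extends the ray
    to negative indices. *)
Lemma ray_addmul w k j : ray w (j * size w + k) = (word w ^+ j * ray w k)%g.
Proof.
elim: k => [|k IH]; last by rewrite addnS /= IH modnMDl !mulgA.
rewrite addn0 mulg1; elim: j => // j IH.
have H k : ray w (size w + k) = (word w * ray w k)%g.
  elim: k => [|k IHk]; first by rewrite addn0 mulg1 ray_take // take_size.
  by rewrite addnS /= IHk modnDl !mulgA.
by rewrite mulSn H IH expgS.
Qed.

(** [|k|] periods are added to make the index nonnegative; by [lineE] any larger
    number of periods would do. *)
Definition line (w : seq bool) (k : int) : PSL2Z :=
  (word w ^- `|k|%N * ray w `|(k + (`|k| * size w)%N%:Z)%R|%N)%g.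

Lemma lineE w k (q j : nat) : w <> [::] -> (`|k| <= q)%N ->
  j%:Z = k + (q * size w)%N%:Z -> (word w ^+ q * line w k)%g = ray w j.
Proof.
move=> w0 kq E; rewrite /line mulgA.
have w1 : (0 < size w)%N by case: w w0 {E}.
have {E} -> : j = ((q - `|k|) * size w + `|(k + (`|k| * size w)%N%:Z)%R|)%N.
  rewrite mulnBl; have := leq_pmulr `|k| w1; have := leq_mul kq (leqnn (size w)).
  move: E; move: (q * _)%N (`|k| * _)%N => x y; lia.
rewrite ray_addmul; congr (_ * _)%g; apply: (mulIg (word w ^+ `|k|)%g).
by rewrite mulgVK -expgnDr subnK.
Qed.

Lemma word_axis w : w <> [::] -> exists g, is_axis (word w) g.
Proof.
move=> w0; have w1 : (0 < size w)%N by case: w w0.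
pose g (k : int) : PSL2Z :=
  (line w (k %/ 2)%Z * (if (k %% 2)%Z == 0 then 1 else S_))%g.
have g0 k : g (2 * k) = line w k.
  by rewrite /g mulrC mulzK // modzMl eqxx mulg1.
have g1 k : g (2 * k + 1) = (line w k * S_)%g.
  rewrite /g; congr (_ * _)%g; last by case: eqP => //; lia.
  congr line; lia.
(* One number [q] of periods serves the indices k, k + 1 and k + size w at once, so relations
   between them can be read off on the ray. *)
have bound k : exists q j : nat, [/\ (`|k| <= q)%N, (`|(k + 1)%R| <= q)%N,
    (`|(k + (size w)%:Z)%R| <= q)%N & j%:Z = k + (q * size w)%N%:Z].
  pose q := (`|k| + size w + 1)%N.
  exists q, `|(k + (q * size w)%N%:Z)%R|%N.
  split; rewrite /q; try lia.
  have := leq_pmulr q w1; rewrite {1}/q -/q; move: (q * _)%N; lia.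
exists (g : int -> farey); split.
  move=> k; rewrite g1 g0; split=> //.
  have -> : 2 * k + 2 = 2 * (k + 1) by ring.
  rewrite g0.
  have [q [j [q0 q1 _ Ej]]] := bound k.
  have E0 := lineE w0 q0 Ej.
  have E1 : (word w ^+ q * line w (k + 1))%g = ray w j.+1.
    by apply: lineE => //; rewrite addrAC -Ej; lia.
  move: E1; rewrite /= -E0 -mulgA => /mulgI ->.
  case: (nth _ _ _); [right|left]; rewrite /= /syl mulgA //=.
  by rewrite -[RHS]mulgA mulRVRV.
have shift k : (word w * line w k)%g = line w (k + (size w)%:Z).
  have [q [j [q0 _ q1 Ej]]] := bound k.
  apply: (mulgI (word w ^+ q)%g).
  rewrite (@lineE w _ q (size w + j)%N) //; last by rewrite PoszD Ej; ring.
  by rewrite -[size w]mul1n ray_addmul -(lineE w0 q0 Ej) !mulgA -expgS -expgSr.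
exists (2 * (size w)%:Z); first by lia.
move=> k; rewrite /g mulgA shift; congr (line w _ * _)%g; first by lia.
by congr (if _ then _ else _); lia.
Qed.

Lemma axis_exists M : hyperbolic M -> exists g, is_axis M g.
Proof.
move=> /hyperbolic_conj_word[V [w [/word_axis[g Mg] ->]]].
by exists (fun k => V * g k)%g; apply: is_axisJ.
Qed.

(** * Reciprocal çarks *)

Definition inverts (V M : PSL2Z) : Prop := (M * V = V * M^-1)%g.

Lemma invertsV V M : inverts V M -> inverts V^-1%g M.
Proof.
rewrite /inverts => E; apply: (mulgI (M * V)%g).
by rewrite {1}E -!mulgA mulKg mulgV mulVKg mulgV.
Qed.

Lemma invertsX V M n : inverts V M -> (M ^+ n * V = V * M ^- n)%g.
Proof.
move=> E; elim: n => [|n IH]; first by rewrite invg1 mulg1 mul1g.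
by rewrite {1}expgSr -mulgA E mulgA IH -mulgA -invgM -expgS.
Qed.

Lemma axis_flip V M d W : inverts V M -> axis M d W ->
  axis M (flip d) (V * W)%g.
Proof.
move=> E [g Mg [k ->]]; exists (fun k => V * g (1 - k))%g.
  exact: is_axis_rev.
case: d; exists (- k) => /=; congr (_ * g _)%g; lia.
Qed.

Lemma flipK d : flip (flip d) = d. Proof. by case: d. Qed.

(** Since [V] carries powers of [M] to inverse powers, left multiplication by [V] descends to the
    cosets of ⟨M⟩. *)
Lemma cark_pi_inverts V M W W' : inverts V M ->
  \pi_(cark_edge M) W = \pi_(cark_edge M) W' ->
  \pi_(cark_edge M) (V * W)%g = \pi_(cark_edge M) (V * W')%g.
Proof.
move=> E /eqmodP/cark_eqE[a [b ab]]; apply/eqmodP/cark_eqE.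
exists b, a; rewrite !mulgA !invertsX // -!mulgA; congr (_ * _)%g.
apply: (mulgI (M ^+ b)%g); rewrite mulVKg.
apply: (mulgI (M ^+ a)%g).
by rewrite ab [in RHS]mulgA -expgnDr addnC expgnDr -!mulgA mulVKg.
Qed.

Lemma inverts_reciprocal_cark V M : inverts V M -> reciprocal_cark (cark M).
Proof.
move=> VM.
have [ph phE] : exists ph : PSL2Z -> cark_edge M -> cark_edge M,
    forall U W, inverts U M ->
    ph U (\pi_(cark_edge M) W) = \pi_(cark_edge M) (U * W)%g.
  exists (fun U e => \pi_(cark_edge M) (U * repr e)%g) => U W UM.
  by apply: cark_pi_inverts; rewrite ?reprK.
have phK U : inverts U M -> cancel (ph U) (ph U^-1%g).
  move=> UM e; rewrite -[e]reprK phE // phE; last exact: invertsV.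
  by rewrite mulKg.
have VM' := invertsV VM.
have phM U e X : inverts U M -> ph U (cark_rmul X e) = cark_rmul X (ph U e).
  by move=> UM; rewrite -[e]reprK cark_rmulE !phE // cark_rmulE mulgA.
exists (ph V).
  by exists (ph V^-1%g); [exact: phK|rewrite -{2}[V]invgK; exact: phK].
(* Each mirror image squares [ccw], so the double mirror has its fourth power, which is [ccw] again;
   only the spine is flipped. *)
have ccw4 (e : cark M) : ccw (ccw (ccw (ccw e))) = ccw e by rewrite ccwK.
split=> [e|e|d e].
- exact: phM.
- by rewrite [RHS]ccw4; apply: phM.
- split=> [[W Wd ->]|[W Wd E]].
    by exists (V * W)%g; [exact: axis_flip|exact: phE].
  exists (V^-1 * W)%g; last by rewrite -phE // -E phK.
  by rewrite -[d]flipK; apply: axis_flip.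
Qed.

Lemma powzE M k : exists n : nat, powz M k = (M ^+ n)%g \/ powz M k = (M ^- n)%g.
Proof. by case: k => n; [exists n; left|exists n.+1; right]. Qed.

Lemma powzC M k : (powz M k * M = M * powz M k)%g.
Proof.
have [n [] ->] := powzE M k; first by rewrite -expgSr expgS.
by apply: (mulgI (M ^+ n)%g); rewrite mulVKg mulgA -expgSr expgS mulgK.
Qed.

Lemma reciprocal_cark_inverts M : hyperbolic M -> reciprocal_cark (cark M) ->
  exists V, inverts V M.
Proof.
move=> hM [phi phi_bij [phi_tw phi_ccw phi_spine]].
have [g Mg] := axis_exists hM.
have ccw4 (e : cark M) : ccw (ccw (ccw (ccw e))) = ccw e by rewrite ccwK.
pose p W : cark M := \pi_(cark_edge M) W.
have [V E1] : exists V, phi (p 1%g) = p V.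
  by exists (repr (phi (p 1%g))); rewrite /p reprK.
(* An isomorphism commutes with the right action of the generators, so it is determined by the image
   of the base edge. *)
have phiE W : phi (p W) = p (V * W)%g.
  elim/psl_ind: W => [|W IH|W IH]; first by rewrite mulg1.
    have -> : p (W * S_)%g = tw (p W) by rewrite /= cark_rmulE.
    by rewrite phi_tw IH /= cark_rmulE mulgA.
  have -> : p (W / R_)%g = ccw (p W) by rewrite /= cark_rmulE.
  by rewrite phi_ccw IH [LHS]ccw4 /= cark_rmulE mulgA.
have pP W W' : p W = p W' -> exists k, W' = (powz M k * W)%g.
  by move=> /eqmodP/asboolP.
have pM W : p (M * W)%g = p W.
  by apply/eqmodP/cark_eqE; exists 0%N, 1%N; rewrite mul1g.
(* As [1] and [M] lie in one coset, so do [V] and [V * M], which puts V M V^-1 into ⟨M⟩; injectivity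
   of [phi] then does the same for V^-1 M V. *)
have [a Ea] : exists a : nat, (V * M = M ^+ a * V)%g \/ (V * M = M ^- a * V)%g.
  have [] : exists k, (V * M = powz M k * V)%g.
    by apply: pP; rewrite -[V in LHS]mulg1 -!phiE -[M in RHS]mulg1 pM.
  by move=> k ->; have [a [] ->] := powzE M k; exists a; [left|right].
have [b Eb] : exists b : nat, (M * V = V * M ^+ b)%g \/ (M * V = V * M ^- b)%g.
  have [] : exists k, (V^-1 * M * V = powz M k * 1)%g.
    apply: pP; apply: (bij_inj phi_bij); rewrite !phiE mulg1 -!mulgA mulVKg.
    by rewrite pM.
  move=> k E; have {E} : (M * V = V * powz M k)%g.
    by rewrite -[powz M k]mulg1 -E -!mulgA mulVKg.
  by move=> ->; have [c [] ->] := powzE M k; exists c; [left|right].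
(* A positive exponent is impossible: [V g] and a translate of an axis [h] of [M] would be axes of
   the same power of [M], running in opposite directions through V g(0) because [phi] flips the
   spine. Exponent 0 would give M = 1. *)
case: Ea => Ea.
  exfalso; case: a Ea => [|a] Ea.
    rewrite mul1g -[RHS]mulg1 in Ea; move/mulgI: Ea => M1.
    by move: hM; rewrite M1 (hyperbolicE entries1).
  have VMa : (M ^+ a.+1)%g = (V * M * V^-1)%g by rewrite Ea mulgK.
  have Vg := is_axisJ V Mg; rewrite -VMa in Vg.
  have /phi_spine[W [h Mh [l ->]] E2] : spine (s := cark M) to_otimes (p (g (2 * 0))).
    by exists (g (2 * 0)) => //; exists g => //; exists 0.
  move: E2; rewrite phiE => /esym/pP[k Ek]; rewrite /= in Ek.
  have XM : (powz M k * M * (powz M k)^-1)%g = M.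
    by rewrite powzC mulgK.
  have := is_axisJ (powz M k) Mh; rewrite XM => /(is_axisX a) Xh.
  apply: (@axis_disjoint (M ^+ a.+1)%g (powz M k * h (2 * l + 1)%R)%g).
    by rewrite -Ek; exists (fun j => V * g j)%g => //; exists 0.
  by exists (fun j => powz M k * h j)%g => //; exists l.
exists V; rewrite /inverts.
suff a1 : a = 1%N.
  apply: (mulgI M^-1%g); rewrite mulKg mulgA.
  rewrite a1 expg1 in Ea; apply: (mulIg M); rewrite mulgVK.
  exact: Ea.
(* Conjugating by V^-1 and then by [V] returns [M], so infinite order makes the product of the two
   signed exponents 1; this excludes one sign and gives ab = 1 for the other. *)
have VMb : (V * M ^+ b = M ^- (a * b) * V)%g.
  rewrite expgnA -expVgn; elim: (b) => [|n IH]; first by rewrite mul1g mulg1.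
  by rewrite expgSr mulgA IH -mulgA Ea mulgA -expgSr.
case: Eb => Eb.
  have /(axis_expg_inj Mg)// : (M ^+ (a * b).+1 = M ^+ 0)%g.
  have E2 : (M = M ^- (a * b))%g by apply: (mulIg V); rewrite Eb VMb.
  by rewrite expgS {1}E2 mulVg.
have /(axis_expg_inj Mg)/eqP : (M ^+ (a * b) = M ^+ 1)%g.
  apply: (mulIg V); apply: (mulgI (M ^- (a * b))%g); rewrite mulKg expg1 Eb.
  by rewrite mulgA -VMb mulgK.
by rewrite muln_eq1 => /andP[/eqP].
Qed.

(** * Reciprocal forms *)

(** Comparing M V with V M^-1 entrywise, the off-diagonal entries give (a + d)q = (a + d)r = 0 and
    the diagonal gives the second equation, which for d = -a says tr(V M) = 0. *)
Lemma inverts_entries V M a b c d p q r s :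
  hyperbolic M -> entries V a b c d -> entries M p q r s ->
  inverts V M <-> a + d = 0 /\ a * (p - s) + b * r + c * q = 0.
Proof.
move=> hM EV EM; have D := entries_det EV; have DM := entries_det EM.
have E1 := entriesM EM EV; have E2 := entriesM EV (entriesV EM).
have tr0 : p + s != 0.
  by apply/eqP => t0; move: hM; rewrite (hyperbolicE EM) t0.
rewrite /inverts; split=> [E|[ad E]].
  rewrite E in E1.
  (* A diagonal matrix of determinant 1 is the identity up to sign, hence not hyperbolic. *)
  have nq : q != 0 \/ r != 0.
    have [q0|] := eqVneq q 0; last by left.
    have [r0|] := eqVneq r 0; last by right.
    exfalso; move: hM; rewrite (hyperbolicE EM).
    move: DM; rewrite q0 mul0r subr0 => ps.
    have := congr1 absz ps; rewrite abszM => /eqP; rewrite muln_eq1.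
    by move=> /andP[/eqP p1 /eqP s1]; lia.
  case: (entries_uniq E1 E2) => -[e1 e2 e3 e4].
    have ad : a + d = 0.
      case: nq => nz; apply: (mulIf nz); rewrite mul0r.
        by apply/eqP; rewrite -subr_eq0; apply/eqP; move: e2; clear; lia.
      by move: e3; clear; lia.
    by split=> //; move: e1; clear; lia.
  (* [M V = - V M^-1] in SL_2(Z) would give tr M = - tr M. *)
  have : (p + s) * (a * d - b * c) = - ((p + s) * (a * d - b * c)).
    transitivity ((p * a + q * c) * d - (p * b + q * d) * c
      - (r * a + s * c) * b + (r * b + s * d) * a); first by ring.
    by rewrite e1 e2 e3 e4; ring.
  by rewrite D mulr1; lia.
apply: entries_inj E1 _; move: E2; have -> : d = - a by lia.
by congr entries; lia.
Qed.

(** Descent on |a|: conjugation by unipotent matrices adds multiples of c or b to a, until a = 0 and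
    the determinant leaves only [S_] up to sign. *)
Lemma traceless_conjS V a b c d : entries V a b c d -> a + d = 0 ->
  exists U, V = (U * S_ * U^-1)%g.
Proof.
have [n] := ubnP `|a|%N; elim: n => // n IH in V a b c d *; rewrite ltnS => lt_n EV ad.
have D := entries_det EV; have dE : d = - a by lia.
rewrite {d ad}dE in D EV.
have step X : (exists U, (X * V * X^-1)%g = (U * S_ * U^-1)%g) ->
    exists U, V = (U * S_ * U^-1)%g.
  move=> [U EU]; exists (X^-1 * U)%g.
  apply: (mulgI X); apply: (mulIg X^-1%g); rewrite EU invgM invgK.
  by rewrite !mulgA mulgV mul1g mulgK.
have [a0|a0] := eqVneq a 0.
  exists 1%g; rewrite mul1g invg1 mulg1.
  have bc : b * - c = 1 by move: D; rewrite a0; clear; lia.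
  have := congr1 absz bc; rewrite abszM => /eqP; rewrite muln_eq1.
  move=> /andP[/eqP b1 /eqP c1]; rewrite a0 oppr0 in EV.
  have [[b2 c2]|[b2 c2]] : (b = -1 /\ c = 1) \/ (b = 1 /\ c = -1).
  - by have [] : b = 1 \/ b = -1; [lia|move=> E; rewrite E in bc *; lia..].
  - by rewrite b2 c2 in EV; apply: entries_inj EV entriesS.
  - rewrite b2 c2 in EV; apply: entries_inj entriesS.
    by have := entriesN EV; rewrite oppr0 opprK.
have lower (k : int) : exists X, entries X 1 0 k 1 by apply: entries_ex; lia.
have upper (k : int) : exists X, entries X 1 k 0 1 by apply: entries_ex; lia.
have shift k : `|k| = 1 -> (`|(a + k * c)%R| < `|a|)%N \/ (`|(a + k * b)%R| < `|a|)%N ->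
    exists U, V = (U * S_ * U^-1)%g.
  move=> k1 [lt|lt].
    have [X EX] := upper k; apply: (step X).
    have E := entriesM (entriesM EX EV) (entriesV EX).
    by apply: IH E _; [move: lt lt_n|]; lia.
  have [X EX] := lower (- k); apply: (step X).
  have E := entriesM (entriesM EX EV) (entriesV EX).
  by apply: IH E _; [move: lt lt_n|]; lia.
have bc : (`|b| * `|c| = `|a| * `|a| + 1)%N.
  by rewrite -!abszM; have -> : b * c = - (a * a + 1); [lia|nia].
have [b0 c0] : (0 < `|b|)%N /\ (0 < `|c|)%N.
  by apply/andP; rewrite -muln_gt0 bc addn1.
(* If |b| and |c| both exceeded |a|, then |bc| would be at least (|a| + 1)^2 > a^2 + 1, as a is
   nonzero. Adding or subtracting such an x once lowers |a|. *)
have [x [x0 x_le xE]] : exists x : int, [/\ x != 0, (`|x| <= `|a|)%N & x = c \/ x = b].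
  have [c_le|lt_c] := leqP `|c| `|a|; first by exists c; split; [lia| |left].
  exists b; split; [lia| |by right]; rewrite leqNgt; apply/negP => lt_b; nia.
have [k [k1 lt_k]] : exists k : int, `|k| = 1 /\ (`|(a + k * x)%R| < `|a|)%N.
  case: (leP 0 a) => sa; case: (leP 0 x) => sx;
    by [exists (-1); lia | exists 1; lia].
by apply: (shift k k1); case: xE lt_k => ->; [left|right].
Qed.

Lemma inverts_conjS V M : hyperbolic M -> inverts V M ->
  exists U, inverts (U * S_ * U^-1)%g M.
Proof.
move=> hM VM; have EV := entries_psl_mx V.
have [ad _] := (inverts_entries hM EV (entries_psl_mx M)).1 VM.
by have [U E] := traceless_conjS EV ad; exists U; rewrite -E.
Qed.

(** The gcd and the sign in f_M amount to one nonzero factor [k], which cancels from the homogeneous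
    condition on the outer coefficients. *)
Lemma bqf_of_scale M p q r s : hyperbolic M -> entries M p q r s ->
  exists2 k : int, k != 0 &
    [/\ k * qa (bqf_of M) = r, k * qb (bqf_of M) = s - p & k * qc (bqf_of M) = - q].
Proof.
move=> hM EM.
have -> : bqf_of M = bqf_mx (mx2 p q r s).
  by rewrite /bqf_of; case: EM => ->; rewrite ?bqf_mxN.
have tr0 : p + s != 0.
  by apply/eqP => t0; move: hM; rewrite (hyperbolicE EM) t0.
rewrite /bqf_mx !mxE /=; set g := gcdz _ r.
have gx : (g %| gcdz q (s - p))%Z := dvdz_gcdl _ _.
have gr : (g %| r)%Z := dvdz_gcdr _ _.
have gq : (g %| - q)%Z by rewrite dvdzE abszN -dvdzE (dvdz_trans gx) ?dvdz_gcdl.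
have gt : (g %| s - p)%Z := dvdz_trans gx (dvdz_gcdr _ _).
have sg2 : sgz (p + s) * sgz (p + s) = 1 by move: tr0; clear; lia.
exists (g * sgz (p + s)).
  rewrite mulf_neq0 ?sgz_eq0 //; apply/eqP => g0.
  rewrite g0 !dvd0z in gq gt; move: hM; rewrite (hyperbolicE EM).
  have := entries_det EM; have -> : q = 0 by lia.
  have -> : s = p by lia.
  rewrite mul0r subr0 => /(congr1 absz)/eqP.
  by rewrite abszM muln_eq1 => /andP[/eqP p1 _]; lia.
by split; rewrite -mulrA [sgz _ * _]mulrA sg2 mul1r mulrC divzK.
Qed.

(** For V = U S U^-1 the trace condition is automatic, and the left side of the other equation in
    [inverts_entries] equals -k times the sum of the outer coefficients of U . f_M. *)
Lemma reciprocal_bqf_act U M : hyperbolic M ->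
  reciprocal_bqf (bqf_act U (bqf_of M)) <-> inverts (U * S_ * U^-1)%g M.
Proof.
move=> hM; have EU := entries_psl_mx U; have EM := entries_psl_mx M.
have [k k0 [Ea Eb Ec]] := bqf_of_scale hM EM.
have -> := inverts_entries hM (entriesM (entriesM EU entriesS) (entriesV EU)) EM.
rewrite /reciprocal_bqf /bqf_act; move: Ea Eb Ec; case: (bqf_of M) => A B C /=.
move: (psl_mx M 0 0) (psl_mx M 0 1) (psl_mx M 1 0) (psl_mx M 1 1) => p q r s.
move: (psl_mx U 0 0) (psl_mx U 0 1) (psl_mx U 1 0) (psl_mx U 1 1) => a b c d.
move=> Ea Eb Ec; rewrite -Ea; have -> : q = - (k * C) by rewrite Ec opprK.
have -> : p - s = - (k * B) by rewrite Eb opprB.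
split=> [E|[_ E]]; last first.
  apply/eqP; rewrite -subr_eq0 opprK; apply/eqP; apply: (mulfI k0).
  by rewrite mulr0 -[RHS]oppr0 -[in RHS]E; ring.
split; first by ring.
transitivity (- k * (A * b ^+ 2 + B * b * d + C * d ^+ 2 +
  (A * a ^+ 2 + B * a * c + C * c ^+ 2))); first by ring.
by rewrite E addNr mulr0.
Qed.

Theorem proposition4p9 (M : PSL2Z) (hM : hyperbolic M) :
  reciprocal_cark (cark M) <->
  exists2 f : bqf, bqf_class (bqf_of M) f & reciprocal_bqf f.
Proof.
split=> [/(reciprocal_cark_inverts hM)[V /(inverts_conjS hM)[U UM]]|].
  exists (bqf_act U (bqf_of M)); first by exists U.
  exact/reciprocal_bqf_act.
move=> [f [U ->] /(reciprocal_bqf_act U hM)].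
exact: inverts_reciprocal_cark.
Qed.
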